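(* Let $G$ be an infinite group generated by a finite symmetric set $S$. Then for every $r\in\mathbb{N}$, $$\mathfrak{C}_{G,S}(r)\;\ge\;\frac{\sqrt{r}}{4|S|},$$ where $\mathfrak{C}_{G,S}$ is the coset covering function of $(G,S)$.
   Context: $G$ is a discrete group and $S$ is a finite symmetric ($S=S^{-1}$) generating set of $G$. $|g|_S$ denotes the word length of $g\in G$ with respect to $S$, and $B_r(G,S)=\{g\in G: |g|_S\le r\}$ is the ball of radius $r$. A coset of infinite index (c.i.i.) of $G$ is a set $C=Hg$ with $g\in G$ and $H\le G$ a subgroup of infinite index. The coset covering function of $(G,S)$ is $$\mathfrak{C}_{G,S}(r)=\min\Big\{N:\ \exists \text{ c.i.i.s } C_1,\dots,C_N \text{ of } G \text{ with } B_r(G,S)\subseteq \bigcup_{i=1}^N C_i\Big\}.$$ The cosets may be cosets of different subgroups. *)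

(* Defs.v *)
From HB Require Import structures.
From mathcomp Require Import all_boot all_order all_algebra finmap.
From mathcomp Require Import boolp classical_sets cardinality reals.

Set Implicit Arguments.
Unset Strict Implicit.
Unset Printing Implicit Defensive.

Local Open Scope classical_set_scope.
Local Open Scope nat_scope.

(* 0 when A is empty, so a positive lower bound on a minimum also asserts that
   the minimum exists. *)
Definition natmin (A : set nat) : nat := xget 0 (A `&` lbound A).

Section Defs.
Context {G : groupType}.
Implicit Types (S : {fset G}) (H C : set G) (g : G) (r N : nat).

Definition subgroup H : Prop := group_closed (mem H).

Definition right_coset H g : set G := [set (h * g)%g | h in H].

Definition infinite_index H : Prop := infinite_set (range (right_coset H)).

Definition cii C : Prop :=
  exists H g, [/\ subgroup H, infinite_index H & C = right_coset H g].

Definition symmetric_fset S : Prop := [fset (s^-1)%g | s in S]%fset = S.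

Definition generating S : Prop := smallest subgroup [set` S] = [set: G].

(* Words have letters in S only, without inverses: the word length is meant for
   symmetric S. *)
Definition word_length S g : nat :=
  natmin [set n | exists w : n.-tuple G,
    all (mem S) w /\ g = (\prod_(s <- w) s)%g].

Definition ball S r : set G := [set g | word_length S g <= r].

Definition coset_covering S r : nat :=
  natmin [set N | exists C : 'I_N -> set G,
    (forall i, cii (C i)) /\ ball S r `<=` \bigcup_i C i].

End Defs.

(* Main.v *)
Require Import Defs.
From HB Require Import structures.
From mathcomp Require Import all_boot all_order all_algebra finmap.
From mathcomp Require Import boolp classical_sets cardinality reals.
From mathcomp Require Import zify ring lra.
Import Order.TTheory GRing.Theory Num.Theory.
Local Open Scope classical_set_scope.
Local Open Scope ring_scope.

(** The ball of radius [r] carries a probability measure that no coset of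
    infinite index charges much, so many such cosets are needed to cover it.
    The measure is the distribution of a simple random walk from the identity,
    stopped at a time chosen uniformly in [0 .. r-1].

    Fix a coset [x = H g] and project the walk to the right cosets of [H].
    Let [F v] be the expected number of the first [r] times at which the walk
    started at [v] sits at [x], and let [d] be the number of generators.
    Three facts about [F] suffice.
    - Its total mass is at most [r], because each letter permutes the cosets.
    - Its discrete Laplacian telescopes in time: it is [d] times the indicator
      of [x], up to a nonpositive term ([laplacian_occupation]). Summing by
      parts, the Dirichlet energy of [F] is at most [2 d M] with [M = max F]
      ([energy_le]).
    - [F] has finite support while the orbit of [x] is infinite, so some path
      starts at a maximum of [F] and ends where [F] vanishes. Stop it when [F]
      has dropped to [M / 2]. The mass bound bounds its length by
      [2 r / M], and then Cauchy-Schwarz makes its energy at least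
      [M ^ 3 / (8 r)] ([energy_ge]).
    Hence [M ^ 2 <= 16 d r] ([occupation_bound]), so [M <= 4 d sqrt r]. If [N]
    cosets cover the ball, the walk is in one of them at each of the [r]
    times, so [r <= N * 4 d sqrt r] ([covering_ge]).

    A minimum over an empty set of coverings would be 0. This does not occur:
    the ball is finite, and in an infinite group each point is a coset of the
    trivial subgroup, which has infinite index ([finite_covering]). *)

(** * Sums over duplicate-free lists *)

Lemma ler_sum_uniq (R : numDomainType) (V : eqType) (A B : seq V) (g : V -> R) :
    uniq A -> uniq B -> (forall v, 0 <= g v) ->
    (forall v, v \in B -> g v != 0 -> v \in A) ->
  \sum_(v <- B) g v <= \sum_(v <- A) g v.
Proof.
move=> Au Bu g0 BA; rewrite (bigID (mem A)) /= [X in _ + X]big1_seq ?addr0.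
  rewrite -big_filter.
  have -> : \sum_(v <- [seq v <- B | v \in A]) g v
          = \sum_(v <- [seq v <- A | v \in B]) g v.
    apply/perm_big/uniq_perm; rewrite ?filter_uniq// => v.
    by rewrite !mem_filter andbC.
  rewrite big_filter [leRHS](bigID (mem B)) /= lerDl.
  by apply: sumr_ge0 => v _.
move=> v /andP[vA vB]; apply/eqP; apply: contraNT vA => /BA; exact.
Qed.

Lemma finite_uniq_seq {V : choiceType} {X : set V} :
  finite_set X -> exists2 A : seq V, uniq A & [set` A] = X.
Proof. by move=> Xfin; exists (fset_set X); rewrite ?fset_uniq// fset_setK. Qed.

(** * Random walks and occupation times *)

Section Walks.
Context {R : realFieldType} {V : choiceType} {I : finType}.
Variable step : I -> V -> V.
Hypothesis step_inj : forall i, injective (step i).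

Definition walk (v : V) (w : seq I) : V := foldl (fun u i => step i u) v w.

Lemma walk_rcons v w i : walk v (rcons w i) = step i (walk v w).
Proof. exact: foldl_rcons. Qed.

Lemma walk_cat v w1 w2 : walk v (w1 ++ w2) = walk (walk v w1) w2.
Proof. exact: foldl_cat. Qed.

(** The expectation of [h] at the endpoint of [n] independent uniformly random
    steps from [v]. *)
Fixpoint mean_after (h : V -> R) (n : nat) (v : V) : R :=
  if n is n'.+1 then (\sum_i mean_after h n' (step i v)) / #|I|%:R else h v.

Definition occupation (h : V -> R) (r : nat) (v : V) : R :=
  \sum_(n < r) mean_after h n v.

Lemma mean_after_ge0 h n v : (forall u, 0 <= h u) -> 0 <= mean_after h n v.
Proof.
move=> h0; elim: n v => //= n IHn v.
by rewrite divr_ge0// sumr_ge0.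
Qed.

Lemma occupation_ge0 h r v : (forall u, 0 <= h u) -> 0 <= occupation h r v.
Proof. by move=> h0; apply: sumr_ge0 => n _; apply: mean_after_ge0. Qed.

(** One more averaging step shifts the summation over time by one, so all
    terms cancel except the first and the last. *)
Lemma laplacian_occupation h r v : (0 < #|I|)%N ->
  #|I|%:R * occupation h r v - \sum_i occupation h r (step i v)
    = #|I|%:R * (h v - mean_after h r v).
Proof.
move=> I0; have I0' : #|I|%:R != 0 :> R by rewrite pnatr_eq0 -lt0n.
elim: r => [|r IHr].
  rewrite /occupation big_ord0 big1 => [|i _]; last by rewrite big_ord0.
  by rewrite mulr0 subr0 /= subrr mulr0.
rewrite /occupation big_ord_recr /=.
under [in X in _ - X]eq_bigr do rewrite big_ord_recr /=.
rewrite big_split /= mulrDr opprD addrACA IHr.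
by rewrite [_ / _]mulrC mulrBr [in RHS]mulrBr mulVKf// addrA subrK.
Qed.

(** Each letter acts injectively, so it maps a duplicate-free list to another
    one. A bound on all such sums therefore survives averaging, which is why
    the hypothesis ranges over every [B]. *)
Lemma mean_after_mass h n (m : R) (A : seq V) : uniq A ->
    (forall B, uniq B -> \sum_(v <- B) h v <= m) ->
  (0 < #|I|)%N -> \sum_(v <- A) mean_after h n v <= m.
Proof.
move=> Au hm I0; elim: n => [|n IHn] /= in A Au *; first exact: hm.
rewrite -mulr_suml ler_pdivrMr ?ltr0n// exchange_big /= mulr_natr -sumr_const.
apply: ler_sum => i _; rewrite -(big_map (step i) xpredT (mean_after h n)).
by apply: IHn; rewrite map_inj_uniq.
Qed.

Lemma finite_mean_after_support h n :
  finite_set [set v | h v != 0] -> finite_set [set v | mean_after h n v != 0].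
Proof.
move=> hfin; elim: n => [//|n IHn].
apply: (@sub_finite_set _ _
  (\bigcup_(i in [set: I]) (step i @^-1` [set v | mean_after h n v != 0]))).
  move=> v /=; apply: contraPP => hv; apply/negP; rewrite negbK.
  rewrite big1 ?mul0r// => i _; apply/eqP; apply: contrapT => /negP hiv.
  by apply: hv; exists i.
apply: bigcup_finite; first exact: finite_finset.
by move=> i _; apply: finite_preimage => // u v _ _; exact: step_inj.
Qed.

Lemma mean_after_walk {h n v} : mean_after h n v != 0 -> exists w, h (walk v w) != 0.
Proof.
elim: n v => [|n IHn] v /=; first by exists [::].
move=> hv; have /existsP[i /IHn[w hw]] : [exists i, mean_after h n (step i v) != 0].
  apply: contraNT hv => /existsPn hv.
  by rewrite big1 ?mul0r// => i _; apply/eqP; rewrite -[_ == _]negbK.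
by exists (i :: w).
Qed.

(** * Dirichlet energy *)

(** Only the edges that leave a vertex of [A] count: a path inside the support
    of [F] up to its last vertex uses no others, and the sum stays finite. *)
Definition energy (A : seq V) (F : V -> R) : R :=
  \sum_(v <- A) \sum_i (F v - F (step i v)) ^+ 2.

(** Summation by parts. Since
    [(a - b)^2 = 2 a (a - b) + (b^2 - a^2)], the defect from the Laplacian
    pairing is [sum_A F(step i v)^2 - sum_A F(v)^2]; it is nonpositive because
    [step i] is injective and [A] contains the support of [F]. *)
Lemma energy_le {A F} : uniq A -> (forall v, F v != 0 -> v \in A) ->
  energy A F <=
    2 * \sum_(v <- A) F v * (#|I|%:R * F v - \sum_i F (step i v)).
Proof.
move=> Au FA.
have -> : energy A F =
    2 * \sum_(v <- A) F v * (#|I|%:R * F v - \sum_i F (step i v)) +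
    \sum_i (\sum_(v <- A) F (step i v) ^+ 2 - \sum_(v <- A) F v ^+ 2).
  have -> : \sum_i (\sum_(v <- A) F (step i v) ^+ 2 - \sum_(v <- A) F v ^+ 2)
          = \sum_(v <- A) \sum_i (F (step i v) ^+ 2 - F v ^+ 2).
    by rewrite exchange_big; apply: eq_bigr => i _; rewrite sumrB.
  rewrite mulr_sumr -big_split /=; apply: eq_bigr => v _.
  rewrite [#|I|%:R * _]mulr_natl -sumr_const -sumrB !mulr_sumr -big_split /=.
  by apply: eq_bigr => i _; ring.
rewrite gerDl; apply: sumr_le0 => i _; rewrite subr_le0.
rewrite -(big_map (step i) xpredT (fun v => F v ^+ 2)).
apply: ler_sum_uniq => //; rewrite ?map_inj_uniq// => v; first exact: sqr_ge0.
by rewrite sqrf_eq0 => _; exact: FA.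
Qed.

(** A shortest walk into [P] avoids [P] before its end, and repeats no vertex
    since a loop could be cut out. *)
Lemma first_visit_walk (P : pred V) v w : P (walk v w) ->
  exists w', [/\ P (walk v w'),
    uniq [seq walk v (take j w') | j <- iota 0 (size w')] &
    forall j, (j < size w')%N -> ~~ P (walk v (take j w'))].
Proof.
move=> Pw; pose Q n := [exists t : n.-tuple I, P (walk v t)].
have Qe : exists n, Q n by exists (size w); apply/existsP; exists (in_tuple w).
case: (ex_minnP Qe) => n /existsP[t Pt] tmin; exists t.
have short u : P (walk v u) -> (n <= size u)%N.
  by move=> Pu; apply: tmin; apply/existsP; exists (in_tuple u).
split=> //.
  rewrite map_inj_in_uniq ?iota_uniq// => j k.
  rewrite !mem_iota !add0n !size_tuple /=.
  wlog jk : j k / (j <= k)%N => [hwlog|_ kn wjk].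
    by case: (leqP j k) => [/hwlog//|/ltnW/hwlog h hj hk e]; apply/esym/h.
  have /short : P (walk v (take j t ++ drop k t)).
    by rewrite walk_cat wjk -walk_cat cat_take_drop.
  rewrite size_cat size_drop size_takel size_tuple ?(leq_trans jk (ltnW kn))//.
  by move: jk kn; lia.
move=> j; rewrite size_tuple => jn; apply/negP => /short.
by rewrite size_take size_tuple jn leqNgt jn.
Qed.

(** The one-dimensional Nash argument: [F] is larger than [F v / 2] along a
    simple path from [v], so the mass bounds the length of the path, and a
    short path on which [F] drops by [F v / 2] is expensive. *)
Lemma energy_ge {A F} {m : R} {v w} : uniq A -> (forall v, 0 <= F v) ->
    (forall v, F v != 0 -> v \in A) -> \sum_(u <- A) F u <= m ->
    F (walk v w) = 0 -> 0 < F v ->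
  F v ^+ 3 <= 8 * m * energy A F.
Proof.
move=> Au F0 FA Fm Fw Fv.
have [|{Fw}w [Fw wu Fj]] := @first_visit_walk (fun u => 2 * F u <= F v) v w.
  by rewrite /= Fw mulr0 ltW.
case: w Fw wu Fj => [|i0 w']; first by rewrite /walk /=; lra.
set w := i0 :: w' => Fw wu Fj.
set k := size w in wu Fj *.
pose y j := walk v (take j w); pose d j := F (y j) - F (y j.+1).
have Fy j : (j < k)%N -> F v < 2 * F (y j) by move=> /Fj; rewrite -ltNge.
have yA j : (j < k)%N -> y j \in A.
  by move=> /Fy Fyj; apply: FA; apply: contraTneq Fyj => ->; rewrite mulr0 -leNgt ltW.
have sumk (c : R) : \sum_(0 <= j < k) c = k%:R * c.
  by rewrite sumr_const_nat subn0 mulr_natl.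
have length_le : k%:R * F v <= 2 * m.
  apply: le_trans (ler_wpM2l _ Fm) => //.
  apply: (@le_trans _ _ (2 * \sum_(0 <= j < k) F (y j))).
    rewrite mulr_sumr -sumk.
    by apply: ler_sum_nat => j /andP[_ /Fy/ltW].
  rewrite ler_wpM2l// -(big_map y xpredT F) /index_iota subn0.
  by apply: ler_sum_uniq => // u _; exact: FA.
have path_energy : \sum_(0 <= j < k) d j ^+ 2 <= energy A F.
  pose e u := \sum_i (F u - F (step i u)) ^+ 2.
  have e0 u : 0 <= e u by apply: sumr_ge0 => i _; exact: sqr_ge0.
  apply: (@le_trans _ _ (\sum_(0 <= j < k) e (y j))).
    apply: ler_sum_nat => j /andP[_ jk].
    rewrite /e (bigD1 (nth i0 w j)) //= -walk_rcons -take_nth// lerDl.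
    by apply: sumr_ge0 => i _; exact: sqr_ge0.
  rewrite -(big_map y xpredT e) /index_iota subn0.
  apply: ler_sum_uniq => // u /mapP[j].
  by rewrite mem_iota => /andP[_ jk] -> _; exact: yA.
have drop : F v <= 2 * \sum_(0 <= j < k) d j.
  have -> : \sum_(0 <= j < k) d j = F v - F (walk v w).
    rewrite -opprB -[F v]/(F (y 0%N)) -{1}(take_size w) -(telescope_sumr (F \o y))//.
    by rewrite -sumrN; apply: eq_bigr => j _; rewrite opprB.
  by move: Fw; lra.
have kk : 0 < k%:R :> R by rewrite ltr0n.
(* Cauchy-Schwarz for a sum of [k] terms, in the form of the nonnegative
   square of each [d j] minus the mean drop [F v / (2 k)], scaled by [2 k]. *)
have cauchy : F v ^+ 2 <= 4 * k%:R * \sum_(0 <= j < k) d j ^+ 2.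
  have : 0 <= \sum_(0 <= j < k) (2 * k%:R * d j - F v) ^+ 2.
    by apply: sumr_ge0 => j _; exact: sqr_ge0.
  have -> : \sum_(0 <= j < k) (2 * k%:R * d j - F v) ^+ 2 =
      k%:R * (4 * k%:R * (\sum_(0 <= j < k) d j ^+ 2) -
              4 * F v * (\sum_(0 <= j < k) d j) + F v ^+ 2).
    rewrite !mulr_sumr -sumrB mulrDr mulr_sumr.
    rewrite -[k%:R * F v ^+ 2]sumk -big_split /=.
    by apply: eq_bigr => j _; ring.
  rewrite pmulr_rge0// => h.
  have : 0 <= F v * (2 * \sum_(0 <= j < k) d j - F v).
    by rewrite mulr_ge0 ?subr_ge0// ltW.
  by move: h; lra.
have E0 : 0 <= energy A F.
  by apply: le_trans path_energy; apply: sumr_ge0 => j _; exact: sqr_ge0.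
apply: (@le_trans _ _ (4 * k%:R * energy A F * F v)).
  rewrite exprSr ler_wpM2r ?(ltW Fv)//; apply: le_trans cauchy _.
  by rewrite ler_wpM2l// mulr_ge0.
have := ler_wpM2r E0 length_le; lra.
Qed.

(** The maximum of the occupation function bounds its own energy from above
    linearly and from below cubically; comparing the two gives the square-root
    growth. *)
Lemma occupation_bound x r v : (0 < #|I|)%N ->
    infinite_set (range (walk x)) ->
  occupation (fun u => (u == x)%:R) r v ^+ 2 <= 16 * #|I|%:R * r%:R.
Proof.
move=> I0 orb; pose h u : R := (u == x)%:R; pose F := occupation h r.
change (F v ^+ 2 <= 16 * #|I|%:R * r%:R).
have h0 u : 0 <= h u by rewrite ler0n.
have hx u : (h u != 0) = (u == x) by rewrite pnatr_eq0 eqb0 negbK.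
have F0 u : 0 <= F u by exact: occupation_ge0.
have Ffin : finite_set [set u | F u != 0].
  apply: (@sub_finite_set _ _ (\bigcup_(n in [set: 'I_r]) [set u | mean_after h n u != 0])).
    move=> u /=; apply: contraPP => hu; apply/negP; rewrite negbK.
    rewrite /F /occupation big1// => n _; apply/eqP; apply: contrapT => /negP hnu.
    by apply: hu; exists n.
  apply: bigcup_finite; first exact: finite_finset.
  move=> n _; apply: finite_mean_after_support.
  apply: (@sub_finite_set _ _ [set x]); last exact: finite_set1.
  by move=> u /=; rewrite hx => /eqP.
have [A Au AE] := finite_uniq_seq Ffin.
have FA u : F u != 0 -> u \in A by move=> Fu; have : [set` A] u by rewrite AE.
have [->|Fv0] := eqVneq (F v) 0; first by rewrite expr0n !mulr_ge0.
(* The support is nonempty and finite, so the supremum is attained. *)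
have [y yA ymax] : exists2 y, F y != 0 & forall u, F u <= F y.
  pose z := [arg max_(z > SeqSub (FA _ Fv0)) F (val z)]%O.
  have zmax u : F u <= F (val z).
    rewrite /z; case: arg_maxP => // {}z _ zmax.
    have [->|/FA uA] := eqVneq (F u) 0; first exact: F0.
    exact: (zmax (SeqSub uA)).
  exists (val z) => //; rewrite gt_eqF// (lt_le_trans _ (zmax v))//.
  by rewrite lt_neqAle eq_sym Fv0 F0.
have Fy : 0 < F y by rewrite lt_neqAle eq_sym yA F0.
have [w Fw] : exists w, F (walk y w) = 0.
  have [n hy] : exists n : 'I_r, mean_after h n y != 0.
    apply/existsP; apply: contraNT yA => /existsPn hy.
    by rewrite /F /occupation big1// => n _; apply/eqP; rewrite -[_ == _]negbK.
  have [w1] := mean_after_walk hy; rewrite -/(h _) hx => /eqP yx.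
  (* A vertex of the support can reach [x], and from [x] the walk can go on to
     any point of an infinite orbit, hence out of the finite support. *)
  have [_ [[w2 _ <-] Fx]] := infinite_setN0 (infinite_setD orb Ffin).
  exists (w1 ++ w2); rewrite walk_cat yx.
  by apply/eqP; apply: contrapT => /negP.
have mass : \sum_(u <- A) F u <= r%:R.
  rewrite exchange_big -[r in leRHS]card_ord -sumr_const /=.
  apply: ler_sum => n _; apply: mean_after_mass => // B Bu.
  apply: (@le_trans _ _ (\sum_(u <- [:: x]) h u)); last by rewrite big_seq1 /h eqxx.
  by apply: ler_sum_uniq => // u _; rewrite hx inE.
(* The Laplacian of [F] is at most [#|I|] at [x] and nonpositive elsewhere. *)
have Ey : energy A F <= 2 * (#|I|%:R * F y).
  apply: le_trans (energy_le Au FA) _; rewrite ler_wpM2l//.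
  apply: (@le_trans _ _ (\sum_(u <- A) #|I|%:R * (F u * h u))).
    apply: ler_sum => u _; rewrite laplacian_occupation// mulrCA ler_wpM2l//.
    by rewrite ler_wpM2l// gerBl mean_after_ge0.
  rewrite -mulr_sumr ler_wpM2l//.
  apply: (@le_trans _ _ (\sum_(u <- [:: x]) F u * h u)).
    apply: ler_sum_uniq => // [u|u _]; first by rewrite mulr_ge0.
    by rewrite mulf_eq0 negb_or hx inE => /andP[].
  by rewrite big_seq1 /h eqxx mulr1.
apply: (@le_trans _ _ (F y ^+ 2)); first by rewrite lerXn2r ?nnegrE.
rewrite -(ler_pM2r Fy) -exprSr.
apply: le_trans (energy_ge Au F0 FA mass Fw Fy) _.
have := ler_wpM2l (_ : 0 <= 8 * r%:R) Ey.
rewrite mulr_ge0// => /(_ isT); lra.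
Qed.

End Walks.

(** * Words and cosets in a finitely generated group *)

(** A nonempty set of naturals has a least element, so the default value is
    never taken. *)
Lemma natminP {A : set nat} {n : nat} :
  A n -> A (natmin A) /\ (natmin A <= n)%N.
Proof.
move=> An; suff [m [Am mA]] : exists m, (A `&` lbound A) m.
  rewrite /natmin; case: xgetP => [k _ [Ak kA]|/(_ m)]; last by case.
  by split=> //; exact: kA.
have Ae : exists m, `[< A m >] by exists n; apply/asboolP.
case: (ex_minnP Ae) => m /asboolP Am mmin; exists m; split=> // k Ak.
exact/mmin/asboolP.
Qed.

Section Groups.
Context {G : groupType}.
Implicit Types (S : {fset G}) (H C : set G) (g : G).

Lemma right_coset_eq {H g k} : subgroup H -> right_coset H g k ->
  right_coset H k = right_coset H g.
Proof.
move=> Hgr [a Ha <-]; have HM := group_closedM Hgr.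
have HV := group_closedV Hgr.
have aH : a \in mem H by exact/mem_set.
apply/seteqP; split=> _ [b Hb <-].
  exists (b * a)%g; last by rewrite mulgA.
  by apply/set_mem/HM => //; exact/mem_set.
exists (b * a^-1)%g; last by rewrite mulgA mulgVK.
by apply/set_mem/HM; [exact/mem_set | exact: HV].
Qed.

Lemma trivial_subgroup : subgroup [set (1%g : G)].
Proof.
split=> [|u v]; first exact/mem_set.
by move=> /set_mem -> /set_mem ->; rewrite divg1; exact/mem_set.
Qed.

Lemma right_coset1 g : right_coset [set 1%g] g = [set g].
Proof. by rewrite /right_coset image_set1 mul1g. Qed.

(** Distinct points are distinct cosets of the trivial subgroup. *)
Lemma cii_set1 g : infinite_set [set: G] -> cii [set g].
Proof.
move=> Ginf; exists [set 1%g], g; split; last by rewrite right_coset1.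
  exact: trivial_subgroup.
move=> fin; apply: Ginf; rewrite -(preimage_range (right_coset [set 1%g])).
apply: finite_preimage fin => k l _ _; rewrite !right_coset1 => kl.
by have : [set l] k by rewrite -kl.
Qed.

Definition translate S (s : S) C : set G := [set (c * val s)%g | c in C].

Lemma translate_inj S (s : S) : injective (translate S s).
Proof.
apply: (@can_inj _ _ _ (fun D => [set (c / val s)%g | c in D])) => C.
by rewrite /translate image_comp eq_image_id// => c _ /=; rewrite mulgK.
Qed.

Lemma walk_right_coset S H g (w : seq S) :
  walk (translate S) (right_coset H g) w
    = right_coset H (g * \prod_(s <- w) val s)%g.
Proof.
elim: w g => [|s w IHw] g /=; first by rewrite big_nil mulg1.
rewrite big_cons mulgA -IHw /walk /=; congr foldl.
rewrite /translate /right_coset image_comp; apply: eq_imagel => h _ /=.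
by rewrite mulgA.
Qed.

(** By symmetry, the products of letters are closed under division, so they
    form a subgroup. *)
Lemma generating_word {S} g : symmetric_fset S -> generating S ->
  exists w : seq S, g = (\prod_(s <- w) val s)%g.
Proof.
move=> Ssym Sgen; pose W := [set g | exists w : seq S, g = (\prod_(s <- w) val s)%g].
suff : smallest subgroup [set` S] `<=` W by apply; rewrite Sgen.
apply: smallest_sub; last first.
  by move=> s Ss; exists [:: [` Ss]%fset]; rewrite big_seq1.
split=> [|u v]; first by apply/mem_set; exists [::]; rewrite big_nil.
move=> /set_mem[w1 ->] /set_mem[w2 ->]; apply/mem_set.
elim: w2 w1 => [|s w2 IHw] w1; first by exists w1; rewrite big_nil divg1.
have sV : ((val s)^-1)%g \in S.
  have : ((val s)^-1)%g \in [fset (t^-1)%g | t in S]%fset.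
    by apply/imfsetP; exists (val s) => //; exact: valP.
  by rewrite Ssym.
have [w ew] := IHw w1; exists (rcons w [` sV]%fset).
by rewrite big_cons -cats1 big_cat big_seq1 /= invgM mulgA ew.
Qed.

(** Words reach every element, so the orbit of a coset under the letters is
    the whole coset space. *)
Lemma infinite_orbit {S H} g : symmetric_fset S -> generating S ->
    infinite_index H ->
  infinite_set (range (walk (translate S) (right_coset H g))).
Proof.
move=> Ssym Sgen; apply: contra_not; apply: sub_finite_set => _ [k _ <-].
have [w ew] := generating_word (g^-1 * k)%g Ssym Sgen.
by exists w => //; rewrite walk_right_coset -ew mulgA mulgV mul1g.
Qed.

Lemma word_of_letters {S} (w : seq S) :
  [set n | exists t : n.-tuple G, all (mem S) t /\
    (\prod_(s <- w) val s)%g = (\prod_(s <- t) s)%g] (size w).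
Proof.
exists (map_tuple val (in_tuple w)); rewrite big_map; split=> //.
by rewrite all_map; apply/allP => s _ /=; exact: valP.
Qed.

Lemma word_length_le {S} (w : seq S) :
  (word_length S (\prod_(s <- w) val s)%g <= size w)%N.
Proof. by have [] := natminP (word_of_letters w). Qed.

Lemma finite_ball {S} r : symmetric_fset S -> generating S ->
  finite_set (ball S r).
Proof.
move=> Ssym Sgen.
pose W := fix W n := if n is n'.+1
  then [set (s * g)%g | s in [set` S] & g in W n'] else [set 1%g].
have WP (t : seq G) : all (mem S) t -> W (size t) (\prod_(s <- t) s)%g.
  elim: t => [|s t IHt] /=; first by rewrite big_nil.
  by case/andP=> sS /IHt tW; rewrite big_cons; exists s => //; eexists; last by [].
apply: (@sub_finite_set _ _ (\bigcup_(n in `I_r.+1) W n)).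
  move=> g gr; have [w gw] := generating_word g Ssym Sgen.
  exists (word_length S g); first by rewrite /= ltnS.
  have [[t [tS gt]] _] := natminP (word_of_letters w).
  by have := WP _ tS; rewrite size_tuple -gt -gw.
apply: bigcup_finite; first exact: finite_II.
move=> n _; elim: n => [|n IHn] /=; first exact: finite_set1.
by apply: finite_image2 => //; exact: finite_fset.
Qed.

Lemma finite_covering {S} r : infinite_set [set: G] -> symmetric_fset S ->
  generating S ->
  [set N | exists C : 'I_N -> set G,
    (forall i, cii (C i)) /\ ball S r `<=` \bigcup_i C i] !=set0.
Proof.
move=> Ginf Ssym Sgen.
have [B _ BE] := finite_uniq_seq (finite_ball r Ssym Sgen).
exists (size B), (fun i => [set tnth (in_tuple B) i]).
split=> [i|g]; first exact: cii_set1.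
by rewrite -BE => /seq_tnthP[i gi]; exists i.
Qed.

(** At each time the walk is still in the ball, hence in one of the cosets, so
    the probabilities of being in the various cosets add up to at least 1. The
    induction starts the walk from an arbitrary word [w]; projecting to the
    cosets of [H i] turns membership in [H i * k i] into equality of cosets. *)
Lemma mean_after_covering (R : realFieldType) S r N (H : 'I_N -> set G) (k : 'I_N -> G)
    n (w : seq S) :
    (forall i, subgroup (H i)) -> (0 < #|{: S}|)%N ->
    ball S r `<=` \bigcup_i right_coset (H i) (k i) -> (size w + n <= r)%N ->
  1 <= \sum_(i < N) mean_after (translate S)
    (fun C => (C == right_coset (H i) (k i))%:R : R) n
    (right_coset (H i) (\prod_(s <- w) val s)%g).
Proof.
move=> Hgr S0 cov; elim: n w => [|n IHn] w /= wr.
  have [|i _ gi] := cov (\prod_(s <- w) val s)%g.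
    by rewrite /ball /=; apply: leq_trans (word_length_le w) _; rewrite -(addn0 (size w)).
  rewrite (bigD1 i)//= (right_coset_eq (Hgr i) gi) eqxx lerDl.
  by apply: sumr_ge0 => j _; rewrite ler0n.
rewrite -mulr_suml ler_pdivlMr ?ltr0n// mul1r exchange_big /= -sumr_const.
apply: ler_sum => s _; have := IHn (rcons w s).
rewrite size_rcons addSnnS => /(_ wr) /le_trans; apply.
apply: ler_sum => i _.
by rewrite -cats1 big_cat -walk_right_coset.
Qed.

(** The bound [16 d r] on the square of each occupation time is relaxed to
    [16 d^2 r], whose square root is [4 d sqrt r]. *)
Lemma covering_ge {R : realType} {S r N} {C : 'I_N -> set G} :
    symmetric_fset S -> generating S ->
    (forall i, cii (C i)) -> ball S r `<=` \bigcup_i C i ->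
  Num.sqrt (r%:R : R) / (4 * #|` S|%:R) <= N%:R.
Proof.
move=> Ssym Sgen Ccii cov; rewrite cardfE; set q := Num.sqrt _.
have [->|S0] := posnP #|{: S}|; first by rewrite mulr0 invr0 mulr0.
have [H HC] := choice Ccii; have [k {}HC] := choice HC.
have Hgr i : subgroup (H i) by have [] := HC i.
have CE i : C i = right_coset (H i) (k i) by have [] := HC i.
have d1 : 1 <= #|{: S}|%:R :> R by rewrite ler1n.
pose F i := occupation (translate S) (fun D => (D == right_coset (H i) (k i))%:R : R) r
  (right_coset (H i) 1%g).
have q0 : 0 <= q by exact: sqrtr_ge0.
have qq : r%:R = q ^+ 2 by rewrite sqr_sqrtr.
have FU i : F i <= 4 * #|{: S}|%:R * q.
  have := @occupation_bound R _ _ _ (@translate_inj S) (right_coset (H i) (k i)) r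
    (right_coset (H i) 1%g) S0.
  have [_ Hinf _] := HC i.
  move=> /(_ (infinite_orbit (k i) Ssym Sgen Hinf)); rewrite -/(F i) => Fb.
  have F0 : 0 <= F i by apply: occupation_ge0 => D; rewrite ler0n.
  rewrite -(@ler_pXn2r _ 2)// ?nnegrE ?mulr_ge0//.
  apply: le_trans Fb _; rewrite qq !exprMn ler_wpM2r ?sqr_ge0//.
  by rewrite -natrX ler_wpM2l// expr2 ler_peMr.
have : q ^+ 2 <= N%:R * (4 * #|{: S}|%:R * q).
  rewrite -qq mulr_natl -[N in leRHS]card_ord -sumr_const.
  apply: (@le_trans _ _ (\sum_i F i)); last by apply: ler_sum => i _; exact: FU.
  rewrite /F /occupation exchange_big -[r in leLHS]card_ord -sumr_const /=.
  apply: ler_sum => n _.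
  have := @mean_after_covering R S r N H k n [::] Hgr S0; rewrite big_nil; apply.
    by move=> g /cov[i _ Cg]; exists i; rewrite -?CE.
  by rewrite add0n ltnW.
rewrite ler_pdivrMr ?mulr_gt0 ?(lt_le_trans ltr01 d1)//.
have [->|qn0 h] := eqVneq q 0; first by rewrite !mulr_ge0.
by rewrite -(@ler_pM2r _ q) ?lt_neqAle 1?eq_sym ?qn0 ?q0// -expr2 -mulrA.
Qed.

End Groups.

Theorem theorem1 (R : realType) (G : groupType) (S : {fset G})
    (G_infinite : infinite_set [set: G])
    (S_symmetric : symmetric_fset S)
    (S_generating : generating S)
    (r : nat) :
  Num.sqrt (r%:R : R) / (4 * #|` S|%:R) <= (coset_covering S r)%:R.
Proof.
have [N /natminP[[C [Ccii cov]] _]] :=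
  finite_covering r G_infinite S_symmetric S_generating.
exact: covering_ge S_symmetric S_generating Ccii cov.
Qed.
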